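(* For every $r$ with $0<r<1$, the caustic of the off-center reflection $R_r$ has exactly $4$ cusp points (counted as parameter values $\phi\in\mathbb{R}/2\pi\mathbb{Z}$). Two of them correspond to the $R_r$-orbit $\{0,\pi\}$ of period $2$, i.e. two of the cusp points occur at the parameter values $\phi=0$ and $\phi=\pi$.
   Context: Points of the unit circle $S^1\subset\mathbb{R}^2$ are written as $\phi \bmod 2\pi$, standing for $(\cos\phi,\sin\phi)$. For $0\le r<1$ the off-center reflection $R_r:S^1\to S^1$ is defined as follows: emit a ray from $(r,0)$ to $z\in S^1$, reflect it at $z$ in the circle (mirror reflection), and let $R_r(z)$ be the other point where the reflected ray meets $S^1$. Analytically, $R_r(\phi)=\phi+\pi-2\alpha(\phi) \pmod{2\pi}$ with $\alpha(\phi)=\operatorname{Arg}(\cos\phi-r+i\sin\phi)-\phi$ for $\phi\in(-\pi,\pi]$, where $\operatorname{Arg}$ takes values in $(-\pi,\pi]$. Derivatives of circle maps are derivatives of their lifts to $\mathbb{R}$. The caustic of a smooth circle map $f:S^1\to S^1$ is the envelope of the family of lines joining $\phi$ to $f(\phi)$; it is the curve parametrized by $$x(\phi)=\frac{f'(\phi)\cos\phi+\cos f(\phi)}{1+f'(\phi)},\qquad y(\phi)=\frac{f'(\phi)\sin\phi+\sin f(\phi)}{1+f'(\phi)}.$$ When $1+f'(\phi)=0$ the caustic of $R_r$ passes through infinity (this happens for some $\phi$ iff $r\ge 1/2$); the caustic is then regarded as a curve in the sphere $\mathbb{R}^2\cup\{\infty\}$, using the coordinate $1/(x+iy)$ near $\infty$.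 A cusp point of the caustic is a parameter value $\phi$ at which the velocity vector of the curve vanishes and at which the tangent direction reverses (the one-sided limits of the unit velocity vector from the left and from the right are opposite). In particular a semicubical cusp, where $x'=y'=0$ and $x''y'''-x'''y''\neq0$, is a cusp point. *)

(* Defs.v *)
From Stdlib Require Import Reals Lra Lia List ClassicalEpsilon ProofIrrelevance.
From Coquelicot Require Export Coquelicot.
Open Scope R_scope.

Definition S1 : Type := {z : C | Cmod z = 1}.

Definition pt (z : S1) : C := proj1_sig z.

Lemma circ_subproof (phi : R) : Cmod (cos phi, sin phi) = 1.
Proof.
unfold Cmod; simpl fst; simpl snd.
replace (cos phi ^ 2 + sin phi ^ 2) with 1; [apply sqrt_1|].
generalize (sin2_cos2 phi); unfold Rsqr; intros H; nra.
Qed.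

(* The point [phi mod 2 pi]. *)
Definition circ (phi : R) : S1 :=
  exist _ ((cos phi, sin phi) : C) (circ_subproof phi).

Lemma S1_eq (z w : S1) : pt z = pt w -> z = w.
Proof.
destruct z as [z Hz], w as [w Hw]; simpl; intros E; subst w.
now rewrite (proof_irrelevance _ Hz Hw).
Qed.

Lemma circ_eq (a b : R) : cos a = cos b -> sin a = sin b -> circ a = circ b.
Proof. intros Hc Hs; apply S1_eq; simpl; now rewrite Hc, Hs. Qed.

(* Principal argument, with values in (-pi, pi]; [Arg 0] is irrelevant. *)
Definition Arg (z : C) : R :=
  if Rle_dec 0 (snd z) then acos (fst z / Cmod z) else - acos (fst z / Cmod z).

Lemma Arg_spec (z : C) : z <> 0%C ->
  - PI < Arg z <= PI /\
  fst z = Cmod z * cos (Arg z) /\ snd z = Cmod z * sin (Arg z).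
Proof.
intros Hz.
assert (Hm : 0 < Cmod z) by now apply Cmod_gt_0.
assert (Hsq : Cmod z * Cmod z = fst z * fst z + snd z * snd z).
{ unfold Cmod; rewrite sqrt_sqrt; nra. }
set (x := fst z / Cmod z).
assert (Ex : fst z = Cmod z * x) by (unfold x; field; lra).
assert (Hx2 : x * x <= 1).
{ apply Rmult_le_reg_l with (Cmod z * Cmod z); [nra|].
  rewrite Ex in Hsq; nra. }
assert (Hx : -1 <= x <= 1) by nra.
assert (Es : Cmod z * sqrt (1 - x²) = Rabs (snd z)).
{ rewrite <- (sqrt_Rsqr (Cmod z)) by lra.
  rewrite <- sqrt_mult by (unfold Rsqr; nra).
  rewrite <- sqrt_Rsqr_abs; f_equal; unfold Rsqr.
  rewrite Ex in Hsq; nra. }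
generalize (acos_bound x); intros Hb.
unfold Arg; fold x; destruct (Rle_dec 0 (snd z)) as [H|H].
- rewrite cos_acos, sin_acos, Es, Rabs_pos_eq by assumption.
  generalize PI_RGT_0; intros; repeat split; lra.
- rewrite cos_neg, sin_neg, cos_acos, sin_acos by assumption.
  rewrite Ropp_mult_distr_r_reverse, Es, Rabs_left by lra.
  repeat split; try lra.
  destruct (Req_dec (acos x) PI) as [E|E]; [|lra].
  exfalso; apply H.
  assert (Ex' : x = -1) by (rewrite <- (cos_acos x Hx), E; apply cos_PI).
  replace (1 - x²) with 0 in Es by (rewrite Ex'; unfold Rsqr; ring).
  rewrite sqrt_0, Rabs_left in Es; lra.
Qed.

Definition is_lift (f : S1 -> S1) (F : R -> R) : Prop :=
  (forall phi, continuous F phi) /\ (forall phi, circ (F phi) = f (circ phi)).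

(* A chosen lift of [f]; meaningful when [f] has one. *)
Definition lift (f : S1 -> S1) : R -> R :=
  epsilon (inhabits (fun phi : R => phi)) (is_lift f).

Definition circle_deriv (f : S1 -> S1) (phi : R) : R := Derive (lift f) phi.

Lemma lift_Derive_unique (f : S1 -> S1) (F G : R -> R) (phi : R) :
  is_lift f F -> is_lift f G -> Derive F phi = Derive G phi.
Proof.
intros [cF HF] [cG HG].
set (H := fun t => F t - G t).
assert (Hz : forall t, cos (H t) = 1).
{ intros t; unfold H; rewrite cos_minus.
  assert (E : circ (F t) = circ (G t)) by now rewrite HF, HG.
  apply (f_equal pt) in E; simpl in E; injection E; intros Es Ec.
  rewrite Es, Ec; generalize (sin2_cos2 (G t)); unfold Rsqr; lra. }
assert (cH : continuous H phi).
{ apply (continuous_minus F G phi); auto. }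
assert (L : locally phi (fun t => F t = G t + H phi)).
{ generalize PI_RGT_0; intros HPI.
  assert (Hp : 0 < 2 * PI) by lra.
  generalize (proj1 (filterlim_locally _ _) cH (mkposreal _ Hp)).
  apply filter_imp; intros t Ht.
  change (Rabs (H t - H phi) < 2 * PI) in Ht.
  assert (C1 : cos (H t - H phi) = 1).
  { rewrite cos_minus, !Hz.
    generalize (sin2_cos2 (H t)) (sin2_cos2 (H phi)); rewrite !Hz.
    unfold Rsqr; intros A B.
    assert (sin (H t) = 0) by nra. nra. }
  assert (D : H t - H phi = 0).
  { set (d := H t - H phi) in *.
    assert (S0 : sin (d / 2) = 0).
    { replace d with (2 * (d / 2)) in C1 by field.
      rewrite cos_2a_sin in C1; nra. }
    apply sin_eq_0_0 in S0; destruct S0 as [k Hk].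
    apply Rabs_def2 in Ht; destruct Ht as [H1 H2].
    assert (K1 : IZR k < 1) by nra.
    assert (K2 : -1 < IZR k) by nra.
    apply lt_IZR in K1; apply lt_IZR in K2.
    assert (k = 0%Z) by lia; subst k; lra. }
  unfold H in *; lra. }
rewrite (Derive_ext_loc _ _ _ L); unfold Derive.
f_equal; apply Lim_ext; intros h; f_equal; ring.
Qed.

Definition alpha (r phi : R) : R := Arg (cos phi - r, sin phi) - phi.

Definition offcenter_reflection (r : R) (z : S1) : S1 :=
  let phi := Arg (pt z) in circ (phi + PI - 2 * alpha r phi).

Lemma offcenter_polar (r phi : R) : 0 <= r < 1 ->
  let d : C := (cos phi - r, sin phi) in
  0 < Cmod d /\
  Cmod d * Cmod d = 1 - 2 * r * cos phi + r * r /\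
  Cmod d * cos (alpha r phi) = 1 - r * cos phi /\
  Cmod d * sin (alpha r phi) = r * sin phi.
Proof.
intros Hr d.
generalize (sin2_cos2 phi) (COS_bound phi); unfold Rsqr; intros H1 Hb.
assert (Hm : Cmod d * Cmod d = 1 - 2 * r * cos phi + r * r).
{ unfold Cmod; rewrite sqrt_sqrt; simpl; nra. }
assert (Hd : d <> 0%C) by (intros E; rewrite E, Cmod_0 in Hm; nra).
destruct (Arg_spec d Hd) as [_ [Ec Es]].
split; [now apply Cmod_gt_0|split; [exact Hm|]].
unfold alpha; fold d; rewrite cos_minus, sin_minus.
simpl fst in Ec; simpl snd in Es.
split.
- transitivity ((Cmod d * cos (Arg d)) * cos phi
                + (Cmod d * sin (Arg d)) * sin phi); [ring|].
  rewrite <- Ec, <- Es; nra.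
- transitivity ((Cmod d * sin (Arg d)) * cos phi
                - (Cmod d * cos (Arg d)) * sin phi); [ring|].
  rewrite <- Ec, <- Es; nra.
Qed.

Lemma pt_Arg (z : S1) : z = circ (Arg (pt z)).
Proof.
destruct z as [z Hz].
assert (N : z <> 0%C) by (intros E; rewrite E, Cmod_0 in Hz; lra).
destruct (Arg_spec z N) as [_ [Ec Es]]; rewrite Hz in Ec, Es.
apply S1_eq; simpl; rewrite (surjective_pairing z) at 1; f_equal; lra.
Qed.

(* The reflected ray: [v = z - (r,0)] is the incoming direction, and
   [v - 2 <v,z> z] its mirror image in the tangent line at [z]. *)
Lemma offcenter_reflection_geom (r : R) (z : S1) : 0 <= r < 1 ->
  let v := (pt z - RtoC r)%C in
  let v' := (v - RtoC (2 * (fst v * fst (pt z) + snd v * snd (pt z))) * pt z)%C in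
  exists t : R, 0 < t /\
    pt (offcenter_reflection r z) = (pt z + RtoC t * v')%C.
Proof.
intros Hr v v'; subst v v'.
assert (E := f_equal pt (pt_Arg z)); simpl in E.
unfold offcenter_reflection.
set (phi := Arg (pt z)) in *; rewrite E; clear E.
destruct (offcenter_polar r phi Hr) as [Hm [Hm2 [Hc Hs]]].
set (m := Cmod _) in *.
generalize (COS_bound phi); intros Hb.
exists (2 * cos (alpha r phi) / m); split.
{ apply Rdiv_lt_0_compat; [|exact Hm].
  assert (0 < cos (alpha r phi)); [|lra].
  apply Rmult_lt_reg_l with m; [exact Hm|]. nra. }
set (a := alpha r phi) in *.
assert (Ec : 2 * cos a / m = 2 * (1 - r * cos phi) / (m * m)).
{ rewrite <- Hc; field; lra. }
rewrite Ec; simpl.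
replace (phi + PI - 2 * a) with ((phi - 2 * a) + PI) by ring.
rewrite neg_cos, neg_sin, cos_minus, sin_minus, cos_2a, sin_2a.
assert (Ca : cos a = (1 - r * cos phi) / m) by (rewrite <- Hc; field; lra).
assert (Sa : sin a = r * sin phi / m) by (rewrite <- Hs; field; lra).
rewrite Ca, Sa.
assert (S2 : sin phi * sin phi = 1 - cos phi * cos phi).
{ generalize (sin2_cos2 phi); unfold Rsqr; lra. }
assert (S3 : sin phi * sin phi * sin phi
             = (1 - cos phi * cos phi) * sin phi) by now rewrite S2.
set (c := cos phi) in *; set (s := sin phi) in *.
assert (Hr2 : r * r = m * m - 1 + 2 * r * c) by lra.
apply injective_projections; simpl;
  apply Rmult_eq_reg_r with (m * m); try nra; field_simplify; try lra.
all: replace (m ^ 2) with (1 - 2 * r * c + r * r) by (rewrite <- Hm2; ring).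
all: replace (s ^ 3) with ((1 - c * c) * s) by (rewrite <- S3; ring).
all: replace (s ^ 2) with (1 - c * c) by (rewrite <- S2; ring).
all: ring.
Qed.

Lemma offcenter_reflection_lift (r : R) : 0 <= r < 1 ->
  is_lift (offcenter_reflection r)
    (fun phi => phi + PI - 2 * atan (r * sin phi / (1 - r * cos phi))).
Proof.
intros Hr; split; intros phi.
- apply (ex_derive_continuous (V := R_NormedModule)).
  generalize (COS_bound phi); intros Hb.
  auto_derive; nra.
- unfold offcenter_reflection.
  assert (E := pt_Arg (circ phi)).
  set (psi := Arg (pt (circ phi))) in *.
  apply (f_equal pt) in E; simpl in E; injection E; intros Es Ec.
  destruct (offcenter_polar r psi Hr) as [Hm [Hm2 [Hc Hs]]].
  set (m := Cmod _) in *; rewrite Es, Ec.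
  generalize (COS_bound psi); intros Hb.
  set (q := r * sin psi / (1 - r * cos psi)).
  set (a := alpha r psi) in *.
  assert (Hk : 0 < 1 - r * cos psi) by nra.
  assert (S2 : sin psi * sin psi = 1 - cos psi * cos psi).
  { generalize (sin2_cos2 psi); unfold Rsqr; lra. }
  assert (Q : sqrt (1 + q²) = m / (1 - r * cos psi)).
  { rewrite <- (sqrt_Rsqr (m / (1 - r * cos psi)));
      [|apply Rlt_le, Rdiv_lt_0_compat; lra].
    f_equal; unfold Rsqr, q.
    apply Rmult_eq_reg_r with ((1 - r * cos psi) * (1 - r * cos psi)); [|nra].
    field_simplify; [|lra|lra].
    replace (m ^ 2) with (1 - 2 * r * cos psi + r * r)
      by (rewrite <- Hm2; ring).
    replace (sin psi ^ 2) with (1 - cos psi * cos psi)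
      by (rewrite <- S2; ring).
    ring. }
  assert (Ca : cos (atan q) = cos a).
  { rewrite cos_atan, Q. apply Rmult_eq_reg_l with m; [|lra].
    rewrite Hc; field; lra. }
  assert (Sa : sin (atan q) = sin a).
  { rewrite sin_atan, Q. apply Rmult_eq_reg_l with m; [|lra].
    rewrite Hs; unfold q; field; lra. }
  apply circ_eq;
    rewrite ?cos_minus, ?sin_minus, ?neg_cos, ?neg_sin, ?cos_2a, ?sin_2a,
      Ca, Sa, Ec, Es; ring.
Qed.

(* The sphere R^2 u {oo}, with [None] standing for oo. *)
Definition sphere : Type := option C.

(* The coordinate x + iy, defined away from oo. *)
Definition affine_coord (p : sphere) : C :=
  match p with Some z => z | None => 0%C end.

(* The coordinate 1 / (x + iy), defined away from 0 and vanishing at oo. *)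
Definition infinity_coord (p : sphere) : C :=
  match p with Some z => (/ z)%C | None => 0%C end.

Definition is_velocity (gamma : R -> C) (phi : R) (v : C) : Prop :=
  is_derive (fun t => Re (gamma t)) phi (Re v) /\
  is_derive (fun t => Im (gamma t)) phi (Im v).

(* [Cmod u = 1] excludes the junk value 0 / 0 = 0 of the unit velocity vector. *)
Definition is_plane_cusp (gamma : R -> C) (phi : R) : Prop :=
  exists v : R -> C,
    locally phi (fun t => is_velocity gamma t (v t)) /\
    v phi = 0%C /\
    exists u : C,
      Cmod u = 1 /\
      filterlim (fun t => (v t / RtoC (Cmod (v t)))%C)
        (at_left phi) (locally u) /\
      filterlim (fun t => (v t / RtoC (Cmod (v t)))%C)
        (at_right phi) (locally (- u)%C).

Definition is_cusp (gamma : R -> sphere) (phi : R) : Prop :=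
  match gamma phi with
  | Some _ => is_plane_cusp (fun t => affine_coord (gamma t)) phi
  | None => is_plane_cusp (fun t => infinity_coord (gamma t)) phi
  end.

Definition caustic (f : S1 -> S1) (phi : R) : sphere :=
  let f' := circle_deriv f phi in
  let w := pt (f (circ phi)) in
  if Req_EM_T (1 + f') 0 then None
  else Some ((f' * cos phi + Re w) / (1 + f'),
             (f' * sin phi + Im w) / (1 + f')).

(* Main.v *)
(* With z = e^(i phi), the caustic of R_r is the curve N / Q, where
   N = - 2 r + 3 r^2 z - r^2 z^3 and Q = 2 (1 - 3 r cos phi + 2 r^2), and its
   velocity factors as
     24 r^2 sin phi (cos phi - r) z (1 - r z) / Q^2.
   Since z (1 - r z) never vanishes, the curve stops exactly at the zeros of
   g = sin phi (cos phi - r), namely 0, pi and +- acos r; these are simple zeros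
   of g, so the direction of travel is reversed there.  N never vanishes either,
   so near infinity the coordinate Q / N is smooth and its velocity is again g
   times a nonvanishing factor.  This covers r = 1/2, where the cusp at phi = 0
   lies at infinity. *)
Require Import Defs.
From Stdlib Require Import Reals Lra List ClassicalEpsilon.
From Coquelicot Require Import Coquelicot.
Open Scope R_scope.

(** * Unit direction vectors and their continuity *)

Definition unit_vec (z : C) : C := (z / RtoC (Cmod z))%C.

Lemma unit_vec_eq (z : C) : z <> 0%C ->
  unit_vec z = (fst z / Cmod z, snd z / Cmod z).
Proof.
intros Hz; generalize (proj1 (Cmod_gt_0 z) Hz); intros Hm.
apply injective_projections; unfold unit_vec; simpl; field; lra.
Qed.

Lemma unit_vec_scal_pos (a : R) (z : C) : 0 < a -> z <> 0%C ->
  unit_vec (RtoC a * z)%C = unit_vec z.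
Proof.
intros Ha Hz; generalize (proj1 (Cmod_gt_0 z) Hz); intros Hm.
unfold unit_vec; rewrite Cmod_mult, Cmod_R, Rabs_pos_eq, RtoC_mult by lra.
field; split; intros E; apply RtoC_inj in E; lra.
Qed.

Lemma unit_vec_opp (z : C) : unit_vec (- z)%C = (- unit_vec z)%C.
Proof. unfold unit_vec, Cdiv; rewrite Cmod_opp; ring. Qed.

Lemma Cmod_unit_vec (z : C) : z <> 0%C -> Cmod (unit_vec z) = 1.
Proof.
intros Hz; generalize (proj1 (Cmod_gt_0 z) Hz); intros Hm.
unfold unit_vec; rewrite Cmod_div.
- rewrite Cmod_R, Rabs_pos_eq by lra; field; lra.
- intros E; apply RtoC_inj in E; lra.
Qed.

Lemma continuous_pair_C (h : R -> C) (phi : R) :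
  continuous (fun t => Re (h t)) phi -> continuous (fun t => Im (h t)) phi ->
  filterlim h (locally phi) (locally (h phi)).
Proof.
intros H1 H2 P [eps HP].
generalize (proj1 (filterlim_locally _ _) H1 eps)
  (proj1 (filterlim_locally _ _) H2 eps); intros L1 L2.
change (locally phi (fun t => P (h t))).
generalize (filter_and _ _ L1 L2); apply filter_imp.
intros t [A B]; apply HP; split; assumption.
Qed.

Lemma Cmod_continuous (h : R -> C) (phi : R) :
  continuous (fun t => Re (h t)) phi -> continuous (fun t => Im (h t)) phi ->
  continuous (fun t => Cmod (h t)) phi.
Proof.
intros H1 H2; unfold Cmod.
apply (continuous_comp (fun t => fst (h t) ^ 2 + snd (h t) ^ 2) sqrt).
- apply (continuous_plus (fun t => fst (h t) ^ 2)).
  + apply (continuous_comp (fun t => fst (h t)) (fun x => x ^ 2)); [exact H1|].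
    apply (ex_derive_continuous (V := R_NormedModule)); auto_derive; trivial.
  + apply (continuous_comp (fun t => snd (h t)) (fun x => x ^ 2)); [exact H2|].
    apply (ex_derive_continuous (V := R_NormedModule)); auto_derive; trivial.
- apply continuous_sqrt.
Qed.

Lemma eventually_neq_0 (h : R -> C) (phi : R) :
  continuous (fun t => Re (h t)) phi -> continuous (fun t => Im (h t)) phi ->
  h phi <> 0%C -> locally phi (fun t => h t <> 0%C).
Proof.
intros H1 H2 Hz.
assert (L : locally phi (fun t => Cmod (h t) <> 0))
  by exact (Cmod_continuous h phi H1 H2 _
    (open_neq 0 _ (fun E => Hz (Cmod_eq_0 _ E)))).
revert L; apply filter_imp; intros t Ht E; apply Ht; rewrite E; apply Cmod_0.
Qed.

Lemma unit_vec_continuous (h : R -> C) (phi : R) :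
  continuous (fun t => Re (h t)) phi -> continuous (fun t => Im (h t)) phi ->
  h phi <> 0%C ->
  filterlim (fun t => unit_vec (h t)) (locally phi) (locally (unit_vec (h phi))).
Proof.
intros H1 H2 Hz.
assert (Hm : Cmod (h phi) <> 0) by (intros E; apply Hz, Cmod_eq_0, E).
assert (Hi : continuous (fun t => / Cmod (h t)) phi).
{ apply continuous_Rinv_comp; [now apply Cmod_continuous|exact Hm]. }
assert (Hu := eventually_neq_0 h phi H1 H2 Hz).
apply filterlim_ext_loc with
  (fun t => ((fst (h t) / Cmod (h t), snd (h t) / Cmod (h t)) : C)).
{ revert Hu; apply filter_imp; intros t Ht; symmetry; now apply unit_vec_eq. }
rewrite unit_vec_eq by assumption.
apply (continuous_pair_C
  (fun t => ((fst (h t) / Cmod (h t), snd (h t) / Cmod (h t)) : C))).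
- exact (continuous_mult _ _ _ H1 Hi).
- exact (continuous_mult _ _ _ H2 Hi).
Qed.

(** * Cusps at simple zeros of a scalar speed *)

(** Near [phi] the difference quotient [g t / (t - phi)] is within [l] of [l], hence positive, so
    [g t] has the sign of [t - phi]. *)
Lemma sign_near_zero (g : R -> R) (phi l : R) :
  is_derive g phi l -> g phi = 0 -> 0 < l ->
  locally phi (fun t => (t < phi -> g t < 0) /\ (phi < t -> 0 < g t)).
Proof.
intros Hd H0 Hl; apply is_derive_Reals in Hd.
destruct (Hd l Hl) as [delta Hdelta].
exists delta; intros t Ht; change R in t; change (Rabs (t - phi) < delta) in Ht.
assert (K : t - phi <> 0 -> 0 < g t / (t - phi)).
{ intros N; generalize (Hdelta (t - phi) N Ht).
  replace (phi + (t - phi)) with t by ring; rewrite H0, Rminus_0_r.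
  intros A; apply Rabs_def2 in A; lra. }
assert (E : t - phi <> 0 -> g t = g t / (t - phi) * (t - phi))
  by (intros N; field; exact N).
split; intros H; (rewrite E by lra); specialize (K ltac:(lra)); nra.
Qed.

Lemma is_velocity_unique (gamma : R -> C) (phi : R) (v w : C) :
  is_velocity gamma phi v -> is_velocity gamma phi w -> v = w.
Proof.
intros [A1 A2] [B1 B2]; apply injective_projections.
- change (Re v = Re w); apply is_derive_unique in A1, B1; congruence.
- change (Im v = Im w); apply is_derive_unique in A2, B2; congruence.
Qed.

(** Positive factors do not affect the unit velocity: it is that of [- h] on the left of [phi] and
    that of [h] on the right, and [h] is continuous and nonzero at [phi]. *)
Lemma plane_cusp_at_simple_zero (gamma : R -> C) (g : R -> R) (h : R -> C)
    (phi l : R) :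
  locally phi (fun t => is_velocity gamma t (RtoC (g t) * h t)%C) ->
  continuous (fun t => Re (h t)) phi -> continuous (fun t => Im (h t)) phi ->
  h phi <> 0%C -> is_derive g phi l -> g phi = 0 -> 0 < l ->
  is_plane_cusp gamma phi.
Proof.
intros Hv H1 H2 Hz Hd H0 Hl.
exists (fun t => (RtoC (g t) * h t)%C); split; [exact Hv|].
split; [rewrite H0; apply Cmult_0_l|].
assert (Hn := eventually_neq_0 h phi H1 H2 Hz).
assert (Hs := sign_near_zero g phi l Hd H0 Hl).
exists (- unit_vec (h phi))%C; split; [|split].
- rewrite Cmod_opp; now apply Cmod_unit_vec.
- rewrite <- unit_vec_opp.
  apply filterlim_ext_loc with (fun t => unit_vec (- h t)%C).
  + unfold at_left, within.
    generalize (filter_and _ _ Hn Hs); apply filter_imp.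
    intros t [Nt [St _]] Ht.
    change (unit_vec (- h t) = unit_vec (RtoC (g t) * h t))%C.
    rewrite <- (unit_vec_scal_pos (- g t) (- h t)%C).
    * f_equal; rewrite RtoC_opp; ring.
    * specialize (St Ht); lra.
    * intros E; apply Nt; replace (h t) with (- - h t)%C by ring.
      rewrite E; ring.
  + eapply filterlim_filter_le_1; [apply filter_le_within|].
    apply (unit_vec_continuous (fun t => (- h t)%C)).
    * exact (continuous_opp _ _ H1).
    * exact (continuous_opp _ _ H2).
    * intros E; apply Hz; replace (h phi) with (- - h phi)%C by ring.
      rewrite E; ring.
- replace (- - unit_vec (h phi))%C with (unit_vec (h phi)) by ring.
  apply filterlim_ext_loc with (fun t => unit_vec (h t)).
  + unfold at_right, within.
    generalize (filter_and _ _ Hn Hs); apply filter_imp.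
    intros t [Nt [_ St]] Ht.
    change (unit_vec (h t) = unit_vec (RtoC (g t) * h t))%C.
    symmetry; apply unit_vec_scal_pos; auto.
  + eapply filterlim_filter_le_1; [apply filter_le_within|].
    now apply unit_vec_continuous.
Qed.

(** If [g phi] is nonzero, so is the velocity, which is unique, and this excludes a cusp. A zero
    with negative slope becomes one with positive slope on passing from [g], [h] to [- g], [- h]. *)
Lemma plane_cusp_iff (gamma : R -> C) (g : R -> R) (h : R -> C) (phi l : R) :
  locally phi (fun t => is_velocity gamma t (RtoC (g t) * h t)%C) ->
  continuous (fun t => Re (h t)) phi -> continuous (fun t => Im (h t)) phi ->
  h phi <> 0%C -> is_derive g phi l -> (g phi = 0 -> l <> 0) ->
  is_plane_cusp gamma phi <-> g phi = 0.
Proof.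
intros Hv H1 H2 Hz Hd Hl; split.
- intros [v [Lv [V0 _]]].
  apply locally_singleton in Hv; apply locally_singleton in Lv.
  assert (E := is_velocity_unique _ _ _ _ Hv Lv); rewrite V0 in E.
  destruct (Req_dec (g phi) 0) as [G|G]; [exact G|exfalso].
  revert E; apply Cmult_neq_0; [|exact Hz].
  intros E; apply RtoC_inj in E; contradiction.
- intros G; destruct (Rtotal_order l 0) as [L|[L|L]].
  + apply (plane_cusp_at_simple_zero gamma (fun t => - g t)
      (fun t => (- h t)%C) phi (- l)); try lra.
    * revert Hv; apply filter_imp; intros t Ht.
      replace (RtoC (- g t) * - h t)%C with (RtoC (g t) * h t)%C; [exact Ht|].
      rewrite RtoC_opp; ring.
    * exact (continuous_opp _ _ H1).
    * exact (continuous_opp _ _ H2).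
    * intros E; apply Hz; replace (h phi) with (- - h phi)%C by ring.
      rewrite E; ring.
    * exact (is_derive_opp g phi l Hd).
  + now destruct (Hl G).
  + now apply (plane_cusp_at_simple_zero gamma g h phi l).
Qed.

(** * Numerator, denominator and direction of the caustic *)

(* With [z = e^(i phi)] the caustic of [R_r] is [caustic_num / caustic_den],
   where [2 caustic_num = - 2 r + 3 r^2 z - r^2 z^3], and its tangent
   direction [z (1 - r z)] is that of the chord from [phi] to [R_r phi]. *)
Definition caustic_den (r t : R) : R := 1 - 3 * r * cos t + 2 * r ^ 2.

Definition caustic_num (r t : R) : C :=
  (- r + 3 * r ^ 2 * cos t - 2 * r ^ 2 * cos t ^ 3, 2 * r ^ 2 * sin t ^ 3).

Definition caustic_dir (r t : R) : C :=
  (cos t - r * (2 * cos t ^ 2 - 1), sin t - 2 * r * sin t * cos t).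

Definition speed_factor (r t : R) : R := sin t * (cos t - r).

Lemma sin2_eq (t : R) : sin t * sin t = 1 - cos t * cos t.
Proof. generalize (sin2_cos2 t); unfold Rsqr; lra. Qed.

Lemma caustic_dir_neq_0 (r t : R) : 0 < r < 1 -> caustic_dir r t <> 0%C.
Proof.
intros Hr E; injection E; intros E2 E1.
generalize (sin2_eq t) (COS_bound t); intros S B.
(* [|z (1 - r z)|^2 = 1 - 2 r cos t + r^2] *)
assert (K : (cos t - r * (2 * cos t ^ 2 - 1)) ^ 2
            + (sin t - 2 * r * sin t * cos t) ^ 2
            = 1 - 2 * r * cos t + r ^ 2).
{ replace ((sin t - 2 * r * sin t * cos t) ^ 2)
    with (sin t * sin t * (1 - 2 * r * cos t) ^ 2) by ring.
  rewrite S; ring. }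
simpl in E1, E2, K; rewrite E1, E2 in K; nra.
Qed.

(** The imaginary part vanishes only where [sin t = 0]; there [cos t] is 1 or -1 and the real part
    is [- r + r ^ 2] or [- r - r ^ 2]. *)
Lemma caustic_num_neq_0 (r t : R) : 0 < r < 1 -> caustic_num r t <> 0%C.
Proof.
intros Hr E; injection E; intros E2 E1.
assert (S0 : sin t = 0).
{ destruct (Req_dec (sin t) 0) as [H|H]; [exact H|exfalso; revert E2].
  repeat apply Rmult_integral_contrapositive_currified; lra. }
assert (C2 := sin2_eq t); rewrite S0 in C2.
assert (K : (cos t - 1) * (cos t + 1) = 0) by lra.
apply Rmult_integral in K; destruct K as [K|K].
- replace (cos t) with 1 in E1 by lra; nra.
- replace (cos t) with (-1) in E1 by lra; nra.
Qed.

(** * Rational formulas for the reflection, its derivative and the caustic *)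

Lemma cos_double_atan (q : R) : cos (2 * atan q) = (1 - q ^ 2) / (1 + q ^ 2).
Proof.
assert (Q : 0 < 1 + q ^ 2) by nra.
rewrite cos_2a, cos_atan, sin_atan.
replace (1 + q²) with (1 + q ^ 2) by (unfold Rsqr; ring).
(* The fifth occurrence is the denominator on the right; the goal becomes a rational identity in [q]
   and the root. *)
rewrite <- (sqrt_sqrt (1 + q ^ 2)) at 5 by lra.
assert (0 < sqrt (1 + q ^ 2)) by now apply sqrt_lt_R0.
field; lra.
Qed.

Lemma sin_double_atan (q : R) : sin (2 * atan q) = 2 * q / (1 + q ^ 2).
Proof.
assert (Q : 0 < 1 + q ^ 2) by nra.
rewrite sin_2a, cos_atan, sin_atan.
replace (1 + q²) with (1 + q ^ 2) by (unfold Rsqr; ring).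
rewrite <- (sqrt_sqrt (1 + q ^ 2)) at 3 by lra.
assert (0 < sqrt (1 + q ^ 2)) by now apply sqrt_lt_R0.
field; lra.
Qed.

(** All continuous lifts have the same derivative, so the chosen one may be replaced by the explicit
    arctangent lift. *)
Lemma offcenter_circle_deriv (r phi : R) : 0 < r < 1 ->
  circle_deriv (offcenter_reflection r) phi
  = (1 - 4 * r * cos phi + 3 * r ^ 2) / (1 - 2 * r * cos phi + r ^ 2).
Proof.
intros Hr.
assert (HF := offcenter_reflection_lift r ltac:(lra)).
assert (HL : is_lift (offcenter_reflection r) (lift (offcenter_reflection r)))
  by exact (epsilon_spec _ _ (ex_intro _ _ HF)).
unfold circle_deriv; rewrite (lift_Derive_unique _ _ _ phi HL HF).
generalize (COS_bound phi) (sin2_eq phi); intros B S.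
assert (K : 0 < 1 - r * cos phi) by nra.
assert (D : (1 - r * cos phi) ^ 2 + (r * sin phi) ^ 2
            = 1 - 2 * r * cos phi + r ^ 2).
{ replace ((r * sin phi) ^ 2) with (r ^ 2 * (sin phi * sin phi)) by ring.
  rewrite S; ring. }
assert (P : 0 < 1 - 2 * r * cos phi + r ^ 2) by nra.
apply is_derive_unique; auto_derive; [lra|].
transitivity (1 - 2 * ((r * cos phi * (1 - r * cos phi)
    - r * r * (sin phi * sin phi))
    / ((1 - r * cos phi) ^ 2 + (r * sin phi) ^ 2))).
- field; split; nra.
- rewrite D, S; field; lra.
Qed.

(** Here [d] is the squared distance from [(r, 0)] to the point of reflection, while [k / d] and
    [sin phi * m / d] are the cosine and sine of the doubled angle of incidence. *)
Lemma offcenter_reflection_coord (r phi : R) : 0 < r < 1 ->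
  let d := 1 - 2 * r * cos phi + r ^ 2 in
  let k := (1 - r * cos phi) ^ 2 - r ^ 2 * (1 - cos phi ^ 2) in
  let m := 2 * r * (1 - r * cos phi) in
  pt (offcenter_reflection r (circ phi))
  = (- (cos phi * k + (1 - cos phi ^ 2) * m) / d,
     - (sin phi * (k - cos phi * m)) / d).
Proof.
intros Hr d k m.
destruct (offcenter_reflection_lift r ltac:(lra)) as [_ HF].
rewrite <- HF; simpl pt.
generalize (COS_bound phi) (sin2_eq phi); intros B S.
assert (K : 0 < 1 - r * cos phi) by nra.
assert (P : 0 < d) by (unfold d; nra).
set (q := r * sin phi / (1 - r * cos phi)).
assert (Q : 1 + q ^ 2 = d / (1 - r * cos phi) ^ 2).
{ unfold q, d; apply Rmult_eq_reg_r with ((1 - r * cos phi) ^ 2); [|nra].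
  field_simplify; [|lra|lra].
  replace (sin phi ^ 2) with (sin phi * sin phi) by ring.
  rewrite S; ring. }
assert (C2 : cos (2 * atan q) = k / d).
{ rewrite cos_double_atan.
  replace (1 - q ^ 2) with (2 - (1 + q ^ 2)) by ring; rewrite Q.
  replace k with (2 * (1 - r * cos phi) ^ 2 - d) by (unfold k, d; ring).
  field; lra. }
assert (S2 : sin (2 * atan q) = sin phi * m / d).
{ rewrite sin_double_atan, Q; unfold q, m; field; lra. }
replace (phi + PI - 2 * atan q) with ((phi - 2 * atan q) + PI) by ring.
rewrite neg_cos, neg_sin, cos_minus, sin_minus, C2, S2.
f_equal.
- replace (1 - cos phi ^ 2) with (sin phi * sin phi) by (rewrite S; ring).
  field; lra.
- field; lra.
Qed.

Lemma caustic_offcenter (r t : R) : 0 < r < 1 ->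
  caustic (offcenter_reflection r) t
  = if Req_EM_T (caustic_den r t) 0 then None
    else Some (fst (caustic_num r t) / caustic_den r t,
               snd (caustic_num r t) / caustic_den r t).
Proof.
intros Hr; unfold caustic.
rewrite offcenter_circle_deriv, offcenter_reflection_coord by assumption.
generalize (COS_bound t) (sin2_eq t); intros B S.
assert (P : 0 < 1 - 2 * r * cos t + r ^ 2) by nra.
set (d := 1 - 2 * r * cos t + r ^ 2) in *.
(* Since [d] is positive, the caustic is at infinity exactly where [caustic_den] vanishes. *)
assert (E : 1 + (1 - 4 * r * cos t + 3 * r ^ 2) / d
            = 2 * caustic_den r t / d)
  by (unfold caustic_den, d; field; unfold d in P; lra).
rewrite E.
destruct (Req_EM_T (2 * caustic_den r t / d) 0) as [Z|Z];
  destruct (Req_EM_T (caustic_den r t) 0) as [Y|Y]; try reflexivity.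
- exfalso; apply Y.
  replace (caustic_den r t) with (2 * caustic_den r t / d * d / 2)
    by (field; lra).
  rewrite Z; field.
- exfalso; apply Z; rewrite Y; field; lra.
- f_equal; unfold caustic_num, Re, Im; simpl fst; simpl snd; f_equal.
  + field; lra.
  + transitivity
      (2 * r ^ 2 * sin t * (1 - cos t * cos t) / caustic_den r t);
      [|rewrite <- S]; field; lra.
Qed.

(** * Velocity of the caustic in the two charts of the sphere *)

Lemma is_velocity_caustic_num (r t : R) :
  is_velocity (caustic_num r) t
    (- 3 * r ^ 2 * sin t + 6 * r ^ 2 * cos t ^ 2 * sin t,
     6 * r ^ 2 * sin t ^ 2 * cos t).
Proof.
split; unfold caustic_num; simpl; auto_derive; trivial; ring.
Qed.

Lemma is_derive_caustic_den (r t : R) :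
  is_derive (caustic_den r) t (3 * r * sin t).
Proof. unfold caustic_den; auto_derive; trivial; ring. Qed.

(* The numerator of the quotient rule for [caustic_num / caustic_den] is a
   real multiple of [caustic_dir]: the caustic is tangent to the chords. *)
Lemma caustic_wronskian (r t : R) :
  (- 3 * r ^ 2 * sin t + 6 * r ^ 2 * cos t ^ 2 * sin t) * caustic_den r t
    - fst (caustic_num r t) * (3 * r * sin t)
  = 6 * r ^ 2 * speed_factor r t * fst (caustic_dir r t) /\
  6 * r ^ 2 * sin t ^ 2 * cos t * caustic_den r t
    - snd (caustic_num r t) * (3 * r * sin t)
  = 6 * r ^ 2 * speed_factor r t * snd (caustic_dir r t).
Proof.
unfold caustic_den, caustic_num, caustic_dir, speed_factor; simpl fst; simpl snd.
split; [ring|].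
transitivity (6 * r ^ 2 * sin t ^ 2
  * (cos t * (1 - 3 * r * cos t + 2 * r ^ 2) - r * (sin t * sin t)));
  [ring|rewrite sin2_eq; ring].
Qed.

Lemma velocity_affine (r t : R) : caustic_den r t <> 0 ->
  is_velocity (fun t => (fst (caustic_num r t) / caustic_den r t,
                         snd (caustic_num r t) / caustic_den r t) : C) t
    (RtoC (speed_factor r t)
     * (RtoC (6 * r ^ 2 / caustic_den r t ^ 2) * caustic_dir r t))%C.
Proof.
intros Hq.
destruct (is_velocity_caustic_num r t) as [N1 N2].
assert (D := is_derive_caustic_den r t).
destruct (caustic_wronskian r t) as [W1 W2].
split.
- evar_last; [exact (is_derive_div _ _ _ _ _ N1 D Hq)|].
  match type of W1 with ?a = _ =>
    transitivity (a / caustic_den r t ^ 2); [simpl|rewrite W1; simpl] end;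
    field; exact Hq.
- evar_last; [exact (is_derive_div _ _ _ _ _ N2 D Hq)|].
  match type of W2 with ?a = _ =>
    transitivity (a / caustic_den r t ^ 2); [simpl|rewrite W2; simpl] end;
    field; exact Hq.
Qed.

Lemma is_velocity_real_div (q p1 p2 : R -> R) (t q' p1' p2' : R) :
  is_derive q t q' -> is_derive p1 t p1' -> is_derive p2 t p2' ->
  ((p1 t, p2 t) : C) <> 0%C ->
  is_velocity (fun t => RtoC (q t) / (p1 t, p2 t))%C t
    ((RtoC q' * (p1 t, p2 t) - RtoC (q t) * (p1', p2'))
     / ((p1 t, p2 t) * (p1 t, p2 t)))%C.
Proof.
intros Hq H1 H2 Hn.
assert (M : 0 < p1 t ^ 2 + p2 t ^ 2).
{ apply Cmod_gt_0 in Hn.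
  destruct (Rle_lt_dec (p1 t ^ 2 + p2 t ^ 2) 0) as [L|L]; [|exact L].
  unfold Cmod in Hn; simpl fst in Hn; simpl snd in Hn.
  (* [sqrt] is 0 on nonpositive arguments, so the modulus would vanish. *)
  rewrite sqrt_neg_0 in Hn by exact L; lra. }
assert (eq := is_derive_unique _ _ _ Hq).
assert (e1 := is_derive_unique _ _ _ H1).
assert (e2 := is_derive_unique _ _ _ H2).
split; simpl; auto_derive; simpl;
  try (repeat split; try (eexists; eassumption); nra);
  change (fun x => q x) with q; change (fun x => p1 x) with p1;
  change (fun x => p2 x) with p2; rewrite eq, e1, e2; field;
  repeat split; nra.
Qed.

(** Inverting the quotient reverses the sign of the numerator in the quotient rule, so the identity
    used in the affine chart applies again, with [- 6 * r ^ 2] for [6 * r ^ 2]. *)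
Lemma velocity_infinity (r t : R) : caustic_num r t <> 0%C ->
  is_velocity (fun t => RtoC (caustic_den r t) / caustic_num r t)%C t
    (RtoC (speed_factor r t)
     * (RtoC (- 6 * r ^ 2) * (caustic_dir r t
        / (caustic_num r t * caustic_num r t))))%C.
Proof.
intros Hn.
destruct (is_velocity_caustic_num r t) as [N1 N2].
assert (D := is_derive_caustic_den r t).
destruct (caustic_wronskian r t) as [W1 W2].
assert (V := is_velocity_real_div _ _ _ _ _ _ _ D N1 N2 Hn).
match type of V with is_velocity _ _ ?v =>
  replace (RtoC (speed_factor r t) * _)%C with v; [exact V|] end.
change (Re (caustic_num r t), Im (caustic_num r t)) with (caustic_num r t).
unfold Cdiv; rewrite !Cmult_assoc; f_equal.
apply injective_projections; simpl.
- revert W1; simpl; lra.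
- revert W2; simpl; lra.
Qed.

Lemma is_velocity_ext_loc (gamma delta : R -> C) (t : R) (v : C) :
  locally t (fun s => gamma s = delta s) ->
  is_velocity gamma t v -> is_velocity delta t v.
Proof.
intros L [H1 H2]; split.
- apply is_derive_ext_loc with (2 := H1).
  revert L; apply filter_imp; intros s E; now rewrite E.
- apply is_derive_ext_loc with (2 := H2).
  revert L; apply filter_imp; intros s E; now rewrite E.
Qed.

(** * Cusps as zeros of the speed factor *)

Lemma is_derive_speed_factor (r t : R) :
  is_derive (speed_factor r) t (cos t * (cos t - r) - sin t ^ 2).
Proof. unfold speed_factor; auto_derive; trivial; ring. Qed.

(** Where [sin t = 0] the derivative is [1 - r] or [1 + r]; where [cos t = r] it is [r ^ 2 - 1]. *)
Lemma speed_factor_simple_zeros (r t : R) : 0 < r < 1 ->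
  speed_factor r t = 0 -> cos t * (cos t - r) - sin t ^ 2 <> 0.
Proof.
unfold speed_factor; intros Hr E.
generalize (sin2_eq t) (COS_bound t); intros S B.
apply Rmult_integral in E; destruct E as [E|E].
- rewrite E in *; nra.
- replace (cos t) with r in * by lra; nra.
Qed.

Lemma is_cusp_offcenter (r phi : R) : 0 < r < 1 ->
  is_cusp (caustic (offcenter_reflection r)) phi <-> speed_factor r phi = 0.
Proof.
intros Hr; unfold is_cusp; rewrite caustic_offcenter by assumption.
destruct (Req_EM_T (caustic_den r phi) 0) as [Q|Q].
- assert (N : forall t, (caustic_num r t * caustic_num r t)%C <> 0%C)
    by (intros t; apply Cmult_neq_0; now apply caustic_num_neq_0).
  assert (M : forall t, fst (caustic_num r t * caustic_num r t)%C ^ 2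
      + snd (caustic_num r t * caustic_num r t)%C ^ 2 <> 0).
  { intros t E; apply (N t), Cmod_eq_0; unfold Cmod; rewrite E; apply sqrt_0. }
  apply plane_cusp_iff with
    (h := fun t => (RtoC (- 6 * r ^ 2) * (caustic_dir r t
        / (caustic_num r t * caustic_num r t)))%C)
    (l := cos phi * (cos phi - r) - sin phi ^ 2).
  + apply filter_forall; intros t.
    (* The coordinate at infinity equals [caustic_den / caustic_num] for every parameter: where the
       denominator of the caustic is zero, both sides are 0. *)
    apply is_velocity_ext_loc with
      (2 := velocity_infinity r t (caustic_num_neq_0 r t Hr)).
    apply filter_forall; intros s.
    rewrite caustic_offcenter by assumption.
    destruct (Req_EM_T (caustic_den r s) 0) as [Y|Y].
    * rewrite Y; apply Cmult_0_l.
    * assert (Hn := caustic_num_neq_0 r s Hr).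
      assert (Yc : RtoC (caustic_den r s) <> 0%C)
        by (intros E; now apply RtoC_inj in E).
      change (RtoC (caustic_den r s) / caustic_num r s
        = / (fst (caustic_num r s) / caustic_den r s,
             snd (caustic_num r s) / caustic_den r s)%R)%C.
      replace (fst (caustic_num r s) / caustic_den r s,
        snd (caustic_num r s) / caustic_den r s)
        with (caustic_num r s / RtoC (caustic_den r s))%C.
      -- field; split; assumption.
      -- apply injective_projections; simpl; field; exact Y.
  + apply (ex_derive_continuous (V := R_NormedModule)).
    simpl; auto_derive; repeat split; exact (M phi).
  + apply (ex_derive_continuous (V := R_NormedModule)).
    simpl; auto_derive; repeat split; exact (M phi).
  + repeat apply Cmult_neq_0.
    * intros E; apply RtoC_inj in E; nra.
    * now apply caustic_dir_neq_0.
    * intros E; apply (f_equal (Cmult (caustic_num r phi * caustic_num r phi))) in E.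
      rewrite Cinv_r, Cmult_0_r in E by apply N; apply RtoC_inj in E; lra.
  + apply is_derive_speed_factor.
  + now apply speed_factor_simple_zeros.
(* By continuity the caustic stays in the affine chart near [phi]. *)
- assert (L : locally phi (fun t => caustic_den r t <> 0)).
  { assert (K : continuous (caustic_den r) phi)
      by (apply (ex_derive_continuous (V := R_NormedModule));
          eexists; apply is_derive_caustic_den).
    exact (K _ (open_neq 0 _ Q)). }
  apply plane_cusp_iff with
    (h := fun t => (RtoC (6 * r ^ 2 / caustic_den r t ^ 2) * caustic_dir r t)%C)
    (l := cos phi * (cos phi - r) - sin phi ^ 2).
  (* The velocity at a nearby [t] requires the affine formula on a whole neighbourhood of [t]. *)
  + generalize (locally_locally _ _ L); apply filter_imp; intros t Lt.
    apply is_velocity_ext_loc with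
      (2 := velocity_affine r t (locally_singleton _ _ Lt)).
    revert Lt; apply filter_imp; intros s Hs.
    rewrite caustic_offcenter by assumption.
    destruct (Req_EM_T (caustic_den r s) 0) as [Y|Y];
      [contradiction|reflexivity].
  + apply (ex_derive_continuous (V := R_NormedModule)).
    unfold caustic_den in Q |- *; simpl in Q |- *; auto_derive.
    repeat split; repeat apply Rmult_integral_contrapositive_currified; lra.
  + apply (ex_derive_continuous (V := R_NormedModule)).
    unfold caustic_den in Q |- *; simpl in Q |- *; auto_derive.
    repeat split; repeat apply Rmult_integral_contrapositive_currified; lra.
  + apply Cmult_neq_0; [|now apply caustic_dir_neq_0].
    intros E; apply RtoC_inj in E; revert E.
    apply Rmult_integral_contrapositive_currified; [nra|].
    now apply Rinv_neq_0_compat, pow_nonzero.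
  + apply is_derive_speed_factor.
  + now apply speed_factor_simple_zeros.
Qed.

(** * The four cusp points on the circle *)

Lemma circ_inj (a b : R) : circ a = circ b -> cos a = cos b /\ sin a = sin b.
Proof.
intros E; apply (f_equal pt) in E; simpl in E; now injection E.
Qed.

Lemma speed_factor_zeros (r phi : R) : -1 <= r <= 1 ->
  speed_factor r phi = 0 <->
  In (circ phi) (circ 0 :: circ PI :: circ (acos r) :: circ (- acos r) :: nil).
Proof.
intros Hr; unfold speed_factor; split.
- intros E; generalize (sin2_eq phi); intros S.
  apply Rmult_integral in E; destruct E as [E|E].
  + rewrite E in S.
    assert (K : (cos phi - 1) * (cos phi + 1) = 0) by lra.
    apply Rmult_integral in K; destruct K as [K|K].
    * left; apply circ_eq; rewrite ?cos_0, ?sin_0; lra.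
    * right; left; apply circ_eq; rewrite ?cos_PI, ?sin_PI; lra.
  + generalize (sin2_eq (acos r)); rewrite cos_acos by exact Hr; intros A.
    replace (cos phi) with r in S by lra.
    (* Both sines have square [1 - r * r], so they agree up to sign. *)
    assert (K : (sin phi - sin (acos r)) * (sin phi + sin (acos r)) = 0) by lra.
    apply Rmult_integral in K; destruct K as [K|K].
    * do 2 right; left; apply circ_eq; rewrite ?cos_acos; lra.
    * do 3 right; left; apply circ_eq;
        rewrite ?cos_neg, ?sin_neg, ?cos_acos; lra.
- intros [E|[E|[E|[E|[]]]]]; apply circ_inj in E; destruct E as [C S];
    rewrite <- C, <- S, ?cos_neg, ?sin_neg, ?sin_0, ?sin_PI, ?cos_acos
      by exact Hr; ring.
Qed.

Theorem theorem3p1 (r : R) (hr0 : 0 < r) (hr1 : r < 1) :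
  exists cusps : list S1,
    NoDup cusps /\ length cusps = 4%nat /\
    (forall phi : R,
       is_cusp (caustic (offcenter_reflection r)) phi <-> In (circ phi) cusps) /\
    In (circ 0) cusps /\ In (circ PI) cusps /\
    circ 0 <> circ PI /\
    offcenter_reflection r (circ 0) = circ PI /\
    offcenter_reflection r (circ PI) = circ 0.
Proof.
assert (S0 : 0 < sin (acos r)).
{ rewrite sin_acos by lra; apply sqrt_lt_R0; unfold Rsqr; nra. }
assert (Cr : cos (acos r) = r) by (apply cos_acos; lra).
exists (circ 0 :: circ PI :: circ (acos r) :: circ (- acos r) :: nil).
split; [|split; [reflexivity|split; [|split; [|split; [|split; [|split]]]]]].
(* The cosines 1, -1 and [r] separate all pairs except the last two points, whose sines are opposite
   and nonzero by [S0]. *)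
- repeat constructor; simpl; intros H;
    repeat (destruct H as [H|H]); try contradiction;
    apply circ_inj in H; destruct H as [H1 H2]; revert H1 H2;
    rewrite ?cos_neg, ?sin_neg, ?cos_0, ?sin_0, ?cos_PI, ?sin_PI, ?Cr; lra.
- intros phi; rewrite is_cusp_offcenter by lra.
  apply speed_factor_zeros; lra.
- now left.
- now right; left.
- intros H; apply circ_inj in H; rewrite cos_0, cos_PI in H; lra.
- destruct (offcenter_reflection_lift r ltac:(lra)) as [_ HF].
  rewrite <- HF; f_equal.
  (* The ray runs along the diameter through [(r, 0)], so the arctangent term vanishes. *)
  rewrite sin_0, Rmult_0_r, Rdiv_0_l, atan_0; ring.
- destruct (offcenter_reflection_lift r ltac:(lra)) as [_ HF].
  rewrite <- HF, sin_PI, Rmult_0_r, Rdiv_0_l, atan_0.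
  replace (PI + PI - 2 * 0) with (2 * PI) by ring.
  apply circ_eq; now rewrite ?cos_2PI, ?sin_2PI, ?cos_0, ?sin_0.
Qed.
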